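(* Let $\alpha_0,\alpha$ be positive rationals and $\varphi(z)=\sum_{n\ge0}\frac{(\alpha)_n}{(\alpha+\alpha_0)_n}z^n$. Let $\theta>1$, $\vartheta>1$, and put \[ a_1=(\vartheta\, d\, s_0\,\epsilon(s_0)\,\epsilon(v))^{1/4}\,\tilde d\,\epsilon(s)\,e^{\theta(s_0/2+s+2v)},\qquad a_2=4\tilde d\,\epsilon(s)\,e^{\theta(r+s+2r_0+2u)}. \] Let $a\neq0$, $b\ge1$, $B\ge1$ be integers and $t\ge0$ real with \[ b\ge(a_1|a|)^6,\qquad B\le b^t. \] Define \[ M_0=\frac{\log b}{\log(a_1|a|)}\max\left\{6\frac{\log(a_2|a|)}{\log b}+\frac12,\ \frac{4t+1}{2},\ \frac14\cdot\frac{\log b}{\log(a_1|a|)},\ \frac{1+\max\{c(\theta),c(\vartheta),4\}}{2}\right\}. \] Then for every $n\in\mathbb{Z}$ and every integer $M\ge M_0$, \[ \left|\varphi\Big(\frac ab\Big)-\frac{n}{Bb^M}\right|\ge\frac{1}{Bb^M\,(a_1^{18}|a|^{17})^M}. \]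
   Context: Pochhammer symbol: $(x)_0=1$, $(x)_n=x(x+1)\cdots(x+n-1)$. Here $\varphi(a/b)$ is the real sum of the series (which converges since $|a/b|<1$). Write $\alpha_0=r_0/s_0$, $\alpha=r/s$, $\alpha_0+\alpha=u/v$ with positive integers in lowest terms; $d$ is the positive integer with $s_0s=dv$; $\tilde d=d/\gcd(d,s_0)$; $\epsilon(n)=\prod_{p\mid n}p^{1/(p-1)}$ (product over primes). $c(\theta)\ge2$ is a real number such that $\pi(x)\le\theta x/\log x$ for all $x\ge c(\theta)$ ($\pi(x)$ the number of primes $\le x$), and $c(\vartheta)>0$ is a real number such that $(n+1)^2<\vartheta^n$ for all integers $n\ge c(\vartheta)$. *)

(* Defs.v *)
From Stdlib Require Import Reals Lra Lia ZArith Arith Znumtheory.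
Open Scope R_scope.

Fixpoint poch (x : R) (n : nat) : R :=
  match n with
  | O => 1
  | S k => poch x k * (x + INR k)
  end.

Definition primeb (p : nat) : bool :=
  if prime_dec (Z.of_nat p) then true else false.

(* epsilon(n) = prod_{p prime, p | n} p^(1/(p-1)) ; primes dividing n>0 are <= n *)
Fixpoint eps_aux (n k : nat) : R :=
  match k with
  | O => 1
  | S j => eps_aux n j *
           (if andb (primeb k) (Nat.eqb (n mod k) 0)
            then Rpower (INR k) (1 / (INR k - 1)) else 1)
  end.
Definition epsilon (n : nat) : R := eps_aux n n.

Fixpoint count_primes (m : nat) : nat :=
  match m with
  | O => O
  | S j => (count_primes j + (if primeb (S j) then 1 else 0))%nat
  end.
Definition prime_pi (x : R) : nat :=
  count_primes (Z.to_nat (Int_part x)).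

(* alpha0 = r0/s0, alpha = r/s in lowest terms; alpha0 + alpha = u/v in lowest terms *)
Definition num_sum (r0 s0 r s : nat) : nat := (r0 * s + r * s0)%nat.
Definition gsum (r0 s0 r s : nat) : nat := Nat.gcd (num_sum r0 s0 r s) (s0 * s).
Definition u_of (r0 s0 r s : nat) : nat := (num_sum r0 s0 r s / gsum r0 s0 r s)%nat.
Definition v_of (r0 s0 r s : nat) : nat := (s0 * s / gsum r0 s0 r s)%nat.
(* d is the positive integer with s0 s = d v *)
Definition d_of (r0 s0 r s : nat) : nat := (s0 * s / v_of r0 s0 r s)%nat.
Definition dt_of (r0 s0 r s : nat) : nat :=
  (d_of r0 s0 r s / Nat.gcd (d_of r0 s0 r s) s0)%nat.

Definition a1_of (r0 s0 r s : nat) (theta vth : R) : R :=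
  let v := v_of r0 s0 r s in
  Rpower (vth * INR (d_of r0 s0 r s) * INR s0 * epsilon s0 * epsilon v) (1/4)
  * INR (dt_of r0 s0 r s) * epsilon s
  * exp (theta * (INR s0 / 2 + INR s + 2 * INR v)).

Definition a2_of (r0 s0 r s : nat) (theta : R) : R :=
  4 * INR (dt_of r0 s0 r s) * epsilon s
  * exp (theta * (INR r + INR s + 2 * INR r0 + 2 * INR (u_of r0 s0 r s))).

(* Main.v *)
Require Import Defs.
From Stdlib Require Import Reals ZArith Arith Znumtheory.
From Stdlib Require Import Lia Lra.
From mathcomp Require all_boot all_order all_algebra Rstruct zify ring lra.
Open Scope R_scope.

(** For [m = M + k], let [P/Q] be the [(m, k)] Padé approximant of
    [phi = sum_l mu_l z^l], so [Q phi - P = O(z^(M+2k+1))].  Its coefficients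
    are products of rising factorials, and the coefficients of [Q phi] in
    degrees [m+1, ..., m+k] are [k]-th differences of polynomials of degree
    [k-1].  With [D = s^(6M) v^(2M) lcm(1, ..., u+2Mv)], both
    [q = D b^k Q(a/b)] and [p = D b^m P(a/b)] are integers, while
    [b^M q phi - p] has size about [D |a|^(M+2k+1) / b^(k+1)]; the denominator
    [b^M q] contains exactly the power of [b] occurring in [n / (B b^M)].
    Hence, if [q n <> B p], then [|q n - B p| >= 1] bounds the distance from
    [phi] to [n / (B b^M)] from below by [1 / (2 B b^M |q|)].  Two consecutive
    values of [k] cannot both give [q n = B p], because
    [Q_(k+1) P_k - Q_k P_(k+1)] is a nonzero monomial in [z].  The choice
    [k + 1 = floor (6 M log(a1 |a|) / log b)] makes the remainder small enough,
    and the hypothesis on [pi] enters through [lcm(1, ..., N) <= N^(pi(N))]. *)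

Definition hyper_sum (al be x : R) (T : nat) : R :=
  sum_f_R0 (fun i => poch al i / poch be i * x ^ i) T.

(** The remainder is bounded on every long enough partial sum, uniformly in [T], so the algebraic
    part never mentions the limit. The factor [IZR b ^ S k] on the left keeps the inequality free of
    divisions. *)
Definition approx_form (al be : R) (a b : Z) (C : R) (M k : nat) (q p : Z) : Prop :=
  Rabs (IZR q) <= C * IZR b ^ k /\
  forall T, (M + k + k <= T)%nat ->
    Rabs (IZR b ^ M * IZR q * hyper_sum al be (IZR a / IZR b) T - IZR p) * IZR b ^ S k
      <= 2 * C * Rabs (IZR a) ^ S (M + k + k).

Module HypergeometricPade.
Import all_boot all_order all_algebra Rstruct ring lra.
Import Order.TTheory GRing.Theory Num.Theory.
Set Implicit Arguments.
Unset Strict Implicit.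
Unset Printing Implicit Defensive.
Local Open Scope nat_scope.

(** * Divisibility *)

Lemma logn_fact_le p n : prime p -> logn p n`! <= n.
Proof.
move=> p_pr; rewrite logn_fact //.
(* The last term of Legendre's sum is counted twice to make the induction close: since [p >= 2],
   twice the next quotient is at most the current one. *)
suff H K : \sum_(1 <= k < K.+1) n %/ p ^ k + n %/ p ^ K <= n.
  by apply: leq_trans (H n); rewrite leq_addr.
elim: K => [|K IH]; first by rewrite big_nil expn0 divn1.
rewrite big_nat_recr //=; apply: leq_trans IH; rewrite -addnA leq_add2l.
rewrite expnSr divnMA addnn -mul2n; set q := n %/ p ^ K.
by apply: leq_trans (leq_trunc_div q p); rewrite mulnC leq_mul2l prime_gt1 ?orbT.
Qed.

(** The truncated subtraction is harmless: both sides are [1] when [n = 0], and both vanish when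
    [x = 0 < n]. *)
Lemma prod_addn_bin x n : \prod_(i < n) (x + i) = 'C(x + n - 1, n) * n`!.
Proof.
rewrite bin_ffact; elim: n x => [|n IH] x; first by rewrite big_ord0 ffactn0.
rewrite big_ord_recr /= IH addnS subSS subn0.
case: n {IH} => [|n]; first by rewrite !ffactn0 addn0 ffactnS ffactn0 muln1 mul1n.
by rewrite [RHS]ffactnS addnS subSS subn0 mulnC.
Qed.

Lemma bin_le_exp2 n k : 'C(n, k) <= 2 ^ n.
Proof.
elim: n k => [|n IH] [|k] //; first by rewrite bin0 expn_gt0.
by rewrite binS expnS mul2n -addnn leq_add.
Qed.

Lemma fact_dvd_rising x n : n`! %| \prod_(i < n) (x + i).
Proof. by rewrite prod_addn_bin dvdn_mull. Qed.

(** Prime by prime: if [p] divides [s] then [s ^ n] absorbs the [p]-part of [n`!];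
    otherwise [s] is invertible modulo it and the progression becomes an interval. *)
Lemma fact_dvd_prog r s n : 0 < s -> n`! %| s ^ n * \prod_(i < n) (r + i * s).
Proof.
move=> s_gt0; apply/dvdn_partP => [|p]; first exact: fact_gt0.
rewrite mem_primes p_part => /and3P[p_pr _ _].
have [p_s|p_s] := boolP (p %| s).
  apply: dvdn_mulr; apply: dvdn_trans (dvdn_exp2r n p_s).
  by apply: dvdn_exp2l; exact: logn_fact_le.
apply: dvdn_mull; set e := logn p n`!.
have co : coprime s (p ^ e) by rewrite coprime_sym coprimeXl // prime_coprime.
have [t t1] : exists t, t * s = 1 %[mod p ^ e].
  case: (egcdnP (p ^ e) s_gt0) => t m E _; exists t.
  by rewrite E (eqP co) -modnDml modnMl add0n.
have co_t : coprime (p ^ e) (t ^ n).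
  apply: coprimeXr; have : coprime (p ^ e) (t * s).
    by rewrite -coprime_modr t1 coprime_modr coprimen1.
  by rewrite coprimeMr => /andP[].
rewrite -(Gauss_dvdr _ co_t).
have -> : (p ^ e %| t ^ n * \prod_(i < n) (r + i * s)) =
  (p ^ e %| \prod_(i < n) (t * r + i)).
  rewrite -[n in t ^ n]card_ord -prod_nat_const -big_split /= /dvdn; congr (_ == _).
  elim/big_ind2: _ => // [a b c d E1 E2|i _]; first by rewrite -modnMm E1 E2 modnMm.
  rewrite mulnDr mulnCA -[LHS]modnDmr -[RHS]modnDmr -modnMmr t1 modnMmr muln1.
  by rewrite modnDmr.
by apply: dvdn_trans (fact_dvd_rising _ _); rewrite /e -p_part dvdn_part.
Qed.

(** This is [lcm(1, ..., N)]. *)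
Definition power_lcm N := \prod_(0 <= p < N.+1 | prime p) p ^ trunc_log p N.

(** Compare prime by prime: the [p]-part of [i] is at most [i <= N], so its exponent is at most
    [trunc_log p N]. *)
Lemma dvdn_power_lcm i N : 0 < i -> i <= N -> i %| power_lcm N.
Proof.
move=> i_gt0 leiN; rewrite -{1}(partnT i_gt0) (widen_partn _ leiN) /power_lcm.
rewrite [X in _ %| X]big_mkcond /= big_mkcond /=.
elim/big_ind2: _ => // [a b c d|p _]; first exact: dvdn_mul.
case: ifP => [p_pr|pNpr].
  apply: dvdn_exp2l; apply: trunc_log_max; first exact: prime_gt1.
  by apply: leq_trans leiN; apply: dvdn_leq => //; rewrite pfactor_dvdn.
by rewrite lognE pNpr.
Qed.

Lemma power_lcm_gt0 N : 0 < power_lcm N.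
Proof. by rewrite prodn_cond_gt0 // => p p_pr; rewrite expn_gt0 prime_gt0. Qed.

(** Links the two notions of primality; the coprimality that [Znumtheory.prime] asks for comes from
    the Bezout coefficients of [egcdn]. *)
Lemma prime_primeb p : prime p -> primeb p = true.
Proof.
move=> p_pr; rewrite /primeb; case: prime_dec => // - [].
have p1 := prime_gt1 p_pr.
apply: Znumtheory.prime_intro; first lia.
move=> n n_lt; apply: bezout_rel_prime.
have n1 : 0 < Z.to_nat n by apply/ssrnat.ltP; lia.
have n2 : Z.to_nat n < p by apply/ssrnat.ltP; lia.
have co : gcdn (Z.to_nat n) p = 1.
  apply/eqP; rewrite -/(coprime _ _) coprime_sym prime_coprime //.
  by apply: contraTN n2 => /(dvdn_leq n1); rewrite -leqNgt.
case: (egcdnP p n1) => x y; rewrite co => E _.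
apply: (@Bezout_intro _ _ _ (Z.of_nat x) (- Z.of_nat y)).
by move: E; rewrite -!plusE -!multE => E; nia.
Qed.

Lemma power_lcm_le N : 0 < N -> power_lcm N <= N ^ count_primes N.
Proof.
move=> N_gt0; rewrite /power_lcm big_mkcond /=.
(* The range [M] is separated from the [N] in the exponents, which stays fixed during the induction;
   each prime contributes one factor at most [N]. *)
suff H M : \prod_(0 <= p < M.+1) (if prime p then p ^ trunc_log p N else 1)
  <= N ^ count_primes M by exact: H.
elim: M => [|M IH]; first by rewrite big_nat1.
rewrite big_nat_recr //= expnD leq_mul //.
case: ifP => [p_pr|_]; last by rewrite expn_gt0 N_gt0.
by rewrite prime_primeb // expn1 trunc_logP ?prime_gt1.
Qed.

(** * Rising factorials and finite differences *)

Local Open Scope ring_scope.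

Section Differences.
Variable R : realFieldType.
Implicit Types (f g : R -> R) (x y c : R) (k n j : nat).

Definition rising x n := \prod_(i < n) (x + i%:R).

Lemma rising0 x : rising x 0 = 1.
Proof. by rewrite /rising big_ord0. Qed.

Lemma risingSr x n : rising x n.+1 = rising x n * (x + n%:R).
Proof. by rewrite /rising big_ord_recr. Qed.

Lemma risingD x m n : rising x (m + n) = rising x m * rising (x + m%:R) n.
Proof.
elim: n => [|n IH]; first by rewrite addn0 rising0 mulr1.
by rewrite addnS !risingSr IH natrD; ring.
Qed.

Lemma risingSl x n : rising x n.+1 = x * rising (x + 1) n.
Proof. by rewrite -add1n risingD risingSr rising0 mul1r addr0. Qed.

Lemma rising_gt0 x n : 0 < x -> 0 < rising x n.
Proof. by move=> x0; apply: prodr_gt0 => i _; rewrite ltr_wpDr. Qed.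

Lemma rising_le x y n : 0 < x -> x <= y -> rising x n <= rising y n.
Proof.
move=> x0 xy; apply: ler_prod => i _.
by rewrite lerD2r xy addr_ge0 // ltW.
Qed.

(** The backward difference acts on arbitrary functions, so it applies to polynomials and to
    [1 / (y + c)] alike. *)
Fixpoint diff k f x :=
  if k is k'.+1 then diff k' f x - diff k' f (x - 1) else f x.

Lemma diffE k f x :
  diff k f x = \sum_(j < k.+1) (-1) ^+ j * 'C(k, j)%:R * f (x - j%:R).
Proof.
elim: k x => [|k IH] x.
  by rewrite big_ord_recl big_ord0 /= subr0 expr0 bin0; ring.
rewrite /= !IH; set g := fun (a : nat) j => (-1) ^+ j * a%:R * f (x - j%:R).
have E : \sum_(j < k.+2) g 'C(k.+1, j) j =
    (\sum_(j < k.+2) g 'C(k, j) j) + \sum_(j < k.+1) g 'C(k, j) j.+1.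
  rewrite big_ord_recl [X in _ = X + _]big_ord_recl -addrA -big_split /=.
  rewrite !bin0; congr (_ + _); apply: eq_bigr => j _.
  by rewrite binS /g natrD mulrDr mulrDl.
have g0 : g 'C(k, k.+1) k.+1 = 0 by rewrite /g bin_small // mulr0 mul0r.
rewrite [RHS]E [X in _ = X + _]big_ord_recr /= -/(g _ _). rewrite g0 addr0; congr (_ + _).
rewrite -sumrN; apply: eq_bigr => j _.
rewrite /g exprS -[j.+1]addn1 natrD opprD addrA.
by rewrite [x - _ - _]addrAC; ring.
Qed.

(** Only the nodes [x - j] with [j <= k] matter, which permits rewriting that is valid away from
    poles only. *)
Lemma eq_diff k f g x : (forall j, (j <= k)%N -> f (x - j%:R) = g (x - j%:R)) ->
  diff k f x = diff k g x.
Proof.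
by move=> E; rewrite !diffE; apply: eq_bigr => j _; rewrite E // -ltnS.
Qed.

Lemma diff_lin k c f g x :
  diff k (fun y => f y + c * g y) x = diff k f x + c * diff k g x.
Proof. by elim: k x => //= k IH x; rewrite !IH; ring. Qed.

(** Leibniz rule for a linear factor, whose second and higher differences vanish. *)
Lemma diff_mulX k f c x : diff k.+1 (fun y => f y * (y + c)) x =
  diff k.+1 f x * (x + c) + k.+1%:R * diff k f (x - 1).
Proof.
elim: k x => [|k IH] x; first by rewrite /=; ring.
rewrite [LHS]/= -!/(diff k.+1 _ _) !IH.
have -> : k.+2%:R = k.+1%:R + 1 :> R by rewrite natr1.
by rewrite /=; ring.
Qed.

(** A degree bound for functions, stated through the only consequence used: higher differences
    vanish. *)
Definition deg_le n f := forall k x, (n < k)%N -> diff k f x = 0.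

Lemma deg_le1 : deg_le 0 (fun=> 1).
Proof.
case=> // k x _; elim: k x => [|k IH] x; first by rewrite /= subrr.
by rewrite -[LHS]/(diff k.+1 _ _ - diff k.+1 _ _) !IH subr0.
Qed.

Lemma deg_le_mulX n f c : deg_le n f -> deg_le n.+1 (fun y => f y * (y + c)).
Proof.
move=> Hf [//|k] x nk; rewrite diff_mulX !Hf ?mul0r ?mulr0 ?addr0 //.
exact: leqW.
Qed.

Lemma deg_le_rising n f c p :
  deg_le n f -> deg_le (n + p) (fun y => f y * rising (y + c) p).
Proof.
move=> Hf; elim: p => [|p IH] k x.
  rewrite addn0 => nk; rewrite -(Hf k x nk); apply: eq_diff => j _.
  by rewrite rising0 mulr1.
rewrite addnS => nk; rewrite -(deg_le_mulX (c + p%:R) IH x nk).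
by apply: eq_diff => j _; rewrite risingSr addrA mulrA.
Qed.

(** The induction step is [1 / (z + 1)_(k+1) - 1 / (z)_(k+1) = - (k + 1) / (z)_(k+2)]; the
    hypothesis keeps all nodes to the right of the pole. *)
Lemma diff_inv k c x : 0 < x + c - k%:R ->
  diff k (fun y => (y + c)^-1) x = (-1) ^+ k * k`!%:R / rising (x + c - k%:R) k.+1.
Proof.
elim: k x => [|k IH] x pos.
  by rewrite /= subr0 expr0 risingSr rising0 !mul1r addr0.
set z := x + c - _ in pos *.
have E1 : x + c - k%:R = z + 1 by rewrite /z -natr1; ring.
have E2 : x - 1 + c - k%:R = z by rewrite /z -natr1; ring.
have p1 : 0 < z + 1 by rewrite addr_gt0.
rewrite /= !IH ?E1 ?E2 //.
rewrite [rising z k.+2]risingSl risingSr [rising z k.+1]risingSl factS natrM exprS.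
have r0 : rising (z + 1) k != 0 by rewrite gt_eqF // rising_gt0 // addr_gt0.
have z0 : z != 0 by rewrite gt_eqF.
have z1 : z + 1 + k%:R != 0 by rewrite gt_eqF // ltr_wpDr // addr_gt0.
by rewrite -[k.+1%:R]natr1; field; rewrite z0 r0 z1.
Qed.

(** Division of [rising y n] by [y + c] leaves a quotient of degree below [k], which the difference
    kills, and as remainder the value at [y = -c], which is the displayed product. The induction
    splits [y + n] as [(y + c) + (n - c)]. *)
Lemma diff_rising_div k n c x : 0 < x + c - k%:R -> (n <= k)%N ->
  diff k (fun y => rising y n / (y + c)) x =
    (\prod_(i < n) (i%:R - c)) * diff k (fun y => (y + c)^-1) x.
Proof.
move=> pos; elim: n => [|n IH] nk.
  by rewrite big_ord0 mul1r; apply: eq_diff => j _; rewrite rising0 mul1r.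
rewrite big_ord_recr /= mulrAC -IH ?(ltnW nk) // mulrC.
rewrite -[RHS]add0r.
have deg : deg_le n (fun y => rising y n).
  move=> l y nl; rewrite -(@deg_le_rising 0 _ 0 n deg_le1 l y nl).
  by apply: eq_diff => j _; rewrite mul1r addr0.
rewrite -(deg k x nk) -diff_lin; apply: eq_diff => j jk.
rewrite risingSr; suff nz : x - j%:R + c != 0 by field.
rewrite gt_eqF // addrAC; apply: lt_le_trans pos _.
by rewrite lerD2l lerN2 ler_nat.
Qed.

End Differences.

(** * Padé approximants *)

(** The geometric series bound, read off Horner's scheme: [2 * S * (1/2) + S = 2 * S]. It does not
    depend on the degree of [p]. *)
Lemma horner_le (R : realFieldType) (p : {poly R}) (S x : R) :
  `|x| <= 2^-1 -> (forall i, `|p`_i| <= S) -> `|p.[x]| <= 2 * S.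
Proof.
move=> x_le; elim/poly_ind: p => [|p c IH] Sp.
  by rewrite horner0 normr0; have := Sp 0%N; rewrite coef0 normr0; lra.
rewrite hornerMXaddC; have /IH Hp : forall i, `|p`_i| <= S.
  by move=> i; have := Sp i.+1; rewrite coefD coefMX coefC /= addr0.
have := Sp 0%N; rewrite coefD coefMX coefC eqxx add0r => Sc.
apply: le_trans (ler_normD _ _) _; rewrite normrM.
have : `|p.[x]| * `|x| <= 2 * S * 2^-1 by apply: ler_pM.
lra.
Qed.

Section Pade.
Variables (R : realFieldType) (al be : R).
Hypotheses (al_gt0 : 0 < al) (al_be : al < be).

Let be_gt0 : 0 < be := lt_trans al_gt0 al_be.

Definition mu l := rising al l / rising be l.

Lemma mu_ge0 l : 0 <= mu l.
Proof. by rewrite divr_ge0 ?ltW ?rising_gt0. Qed.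

Lemma mu_le1 l : mu l <= 1.
Proof. by rewrite ler_pdivrMr ?rising_gt0 // mul1r rising_le // ltW. Qed.

(** For [k <= m] these are the coefficients of [(be + m)_k / k!] times the Gauss polynomial
    [2F1(-k, -al - m; 1 - be - m - k; z)]. Each rising factorial is paired with a factorial of the
    same length, the form in which its denominator is controlled. *)
Definition pade_q m k j := (-1) ^+ j *
  (rising (al + (m.+1 - j)%:R) j / j`!%:R) *
  (rising (be + m%:R) (k - j) / (k - j)`!%:R).

(** The full coefficient sequence of [Q phi]; the numerator keeps the degrees at
    most [m]. *)
Definition pade_p m k N :=
  \sum_(j < k.+1) pade_q m k j * (if (j <= N)%N then mu (N - j) else 0).

(** The two rising factorials in [al] merge into the constant [rising al m.+1] and a function of
    [y = al + m + 1 - j]. What depends on [j] is then a signed binomial times a function of [y],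
    that is, a term of a [k]-th difference. *)
Lemma pade_q_mu m k i j : (j <= k)%N -> (k <= m)%N ->
  pade_q m k j * mu (m.+1 + i - j) =
  rising al m.+1 / (k`!%:R * rising be m) *
  ((-1) ^+ j * 'C(k, j)%:R *
    (rising (al + m.+1%:R - j%:R) i *
      (rising be (m + k - j) / rising be (m.+1 + i - j)))).
Proof.
move=> jk km; have jm : (j <= m.+1)%N by apply: leq_trans jk (leqW km).
have -> : (m + k - j = m + (k - j))%N by rewrite addnBA.
rewrite risingD /pade_q /mu.
have -> : rising al (m.+1 + i - j) =
    rising al (m.+1 - j) * rising (al + (m.+1 - j)%:R) i.
  by rewrite -risingD addnBAC.
have -> : rising al m.+1 = rising al (m.+1 - j) * rising (al + (m.+1 - j)%:R) j.
  by rewrite -risingD subnK.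
have := bin_fact jk => /(congr1 (fun n => n%:R : R)); rewrite !natrM => <-.
rewrite -[al + _ - _]addrA -natrB //.
have nz n : n`!%:R != 0 :> R by rewrite pnatr_eq0 -lt0n fact_gt0.
have C0 : 'C(k, j)%:R != 0 :> R by rewrite pnatr_eq0 -lt0n bin_gt0.
have r0 n : rising be n != 0 by rewrite gt_eqF // rising_gt0.
by field; rewrite C0 !nz !r0.
Qed.

Lemma sum_pade_q_mu m k i (g : R -> R) : (k <= m)%N ->
  (forall j, (j <= k)%N ->
    rising (al + m.+1%:R - j%:R) i *
      (rising be (m + k - j) / rising be (m.+1 + i - j)) =
    g (al + m.+1%:R - j%:R)) ->
  \sum_(j < k.+1) pade_q m k j * mu (m.+1 + i - j) =
  rising al m.+1 / (k`!%:R * rising be m) * diff k g (al + m.+1%:R).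
Proof.
move=> km E; rewrite diffE mulr_sumr; apply: eq_bigr => j _.
have jk : (j <= k)%N by rewrite -ltnS.
by rewrite pade_q_mu // E.
Qed.

Lemma pade_p_eq m k i : (k <= m)%N ->
  pade_p m k (m.+1 + i) = \sum_(j < k.+1) pade_q m k j * mu (m.+1 + i - j).
Proof.
move=> km; apply: eq_bigr => j _; have jk : (j <= k)%N by rewrite -ltnS.
by rewrite (leq_trans jk) // (leq_trans km) // ltnW // leq_addr.
Qed.

Lemma pade_p_eq0 m k N : (k <= m)%N -> (m < N <= m + k)%N -> pade_p m k N = 0.
Proof.
move=> km /andP[mN Nmk]; rewrite -(subnKC mN); set i := (N - m.+1)%N.
have ik : (i < k)%N by rewrite /i; lia.
(* For [i < k] the quotient of the rising factorials in [be] is a product of [k - i - 1] factors, so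
   [g] has degree [i + (k - i - 1) = k - 1]. *)
pose g y := rising (y + 0) i * rising (y + (be - al + i%:R)) (k - i.+1).
rewrite pade_p_eq // (sum_pade_q_mu (g := g)) //.
  rewrite [diff _ _ _](_ : _ = 0) ?mulr0 //.
  have d1 : deg_le i (fun y : R => rising (y + 0) i).
    move=> l y il; rewrite -[RHS](@deg_le_rising _ 0 _ 0 i (@deg_le1 R) l y il).
    by apply: eq_diff => j _; rewrite mul1r.
  by apply: (@deg_le_rising _ i _ (be - al + i%:R) (k - i.+1) d1); lia.
move=> j jk; rewrite /g addr0; congr (_ * _).
have -> : (m + k - j = (m.+1 + i - j) + (k - i.+1))%N.
  have jm : (j <= m)%N := leq_trans jk km.
  lia.
rewrite risingD mulrC mulKf ?gt_eqF ?rising_gt0 //.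
congr (rising _ _); rewrite natrB ?natrD; first ring.
by rewrite (leq_trans jk) // (leq_trans km) // ltnW // leq_addr.
Qed.

Lemma pade_p_neq0 m k : (k <= m)%N -> pade_p m k (m.+1 + k) != 0.
Proof.
(* In the first degree after the gap the quotient in [be] is [1 / (be + m + k - j)], and [c] is the
   shift making its denominator [y + c] at [y = al + m + 1 - j]. *)
move=> km; pose c := be - al + k%:R - 1.
rewrite pade_p_eq // (sum_pade_q_mu (g := fun y => rising y k / (y + c))) //.
  have pos : 0 < al + m.+1%:R + c - k%:R.
    rewrite (_ : _ - _ = be + m%:R) ?ltr_wpDr //.
    by rewrite /c -natr1; ring.
  rewrite diff_rising_div // diff_inv //.
  (* Since [al < be], [c > k - 1 >= i]. *)
  have P0 : \prod_(i < k) (i%:R - c) != 0.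
    apply/prodf_neq0 => i _; rewrite lt_eqF // /c.
    have : i.+1%:R <= k%:R :> R by rewrite ler_nat.
    by rewrite -natr1; move: al_be; lra.
  have fact_neq0 : k`!%:R != 0 :> R by rewrite pnatr_eq0 -lt0n fact_gt0.
  apply: mulf_neq0.
    by rewrite gt_eqF // divr_gt0 ?mulr_gt0 ?rising_gt0 ?ltr0n ?fact_gt0 // ltr_wpDr.
  rewrite mulf_neq0 // mulf_neq0 //; first by rewrite mulf_neq0 ?signr_eq0.
  by rewrite invr_neq0 // gt_eqF // rising_gt0.
move=> j jk; congr (_ * _).
have -> : (m.+1 + k - j = (m + k - j).+1)%N.
  by rewrite -subSn // (leq_trans jk) // leq_addl.
rewrite risingSr invfM mulrA divff ?gt_eqF ?rising_gt0 // mul1r.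
congr (_^-1); rewrite /c natrB ?natrD -?natr1 ?(leq_trans jk) ?leq_addl //; ring.
Qed.

Definition padeQ m k := \poly_(j < k.+1) pade_q m k j.
Definition padeP m k := \poly_(N < m.+1) pade_p m k N.
Definition padeS m k := \sum_(j < k.+1) `|pade_q m k j|.
Definition partial T := \poly_(i < T) mu i.

Lemma coef_padeQ_partial m k T N : (padeQ m k * partial T)`_N =
  \sum_(j < k.+1) pade_q m k j *
    (if (j <= N)%N && (N - j < T)%N then mu (N - j) else 0).
Proof.
rewrite /padeQ poly_def mulr_suml coef_sum; apply: eq_bigr => j _.
rewrite -scalerAl coefZ coefXnM coef_poly.
by case: (leqP j N).
Qed.

(** Truncating [phi] at degree [T] replaces power series by polynomials; as [0 <= mu <= 1], the
    coefficient bounds for the remainder do not depend on [T]. *)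
Definition pade_rem m k T := drop_poly (m.+1 + k) (padeQ m k * partial T).

Lemma pade_eq m k T : (k <= m)%N -> (m + k < T)%N ->
  padeQ m k * partial T = padeP m k + pade_rem m k T * 'X^(m.+1 + k).
Proof.
move=> km mkT; apply/polyP => N.
rewrite coefD coefMXn coef_drop_poly coef_poly.
have [N_mk|mk_N] := ltnP N (m.+1 + k); last first.
  by rewrite subnK // ifN ?add0r // -leqNgt; lia.
(* Since [m + k < T], the truncation does not reach these degrees. *)
have -> : (padeQ m k * partial T)`_N = pade_p m k N.
  rewrite coef_padeQ_partial; apply: eq_bigr => j _.
  by rewrite (leq_ltn_trans (leq_subr _ _)) ?andbT // (leq_trans N_mk).
rewrite addr0; case: leqP => // mN; apply: pade_p_eq0 => //.
by rewrite mN -ltnS -addSn.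
Qed.

Lemma pade_rem_coef_le m k T i : `|(pade_rem m k T)`_i| <= padeS m k.
Proof.
rewrite coef_drop_poly coef_padeQ_partial.
apply: le_trans (ler_norm_sum _ _ _) _; apply: ler_sum => j _.
rewrite normrM ler_piMr //; case: ifP => _; rewrite ?normr0 //.
by rewrite ger0_norm ?mu_ge0 ?mu_le1.
Qed.

Lemma pade_rem_coef0 m k T : (k <= m)%N -> (m.+1 + k < T)%N ->
  (pade_rem m k T)`_0 != 0.
Proof.
move=> km mkT; rewrite coef_drop_poly add0n coef_padeQ_partial.
rewrite [X in X != 0](_ : _ = pade_p m k (m.+1 + k)) ?pade_p_neq0 //.
apply: eq_bigr => j _.
by rewrite (leq_ltn_trans (leq_subr _ _)) ?andbT.
Qed.

Lemma pade_remainder m k T x : (k <= m)%N -> (m + k < T)%N -> `|x| <= 2^-1 ->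
  `|(padeQ m k).[x] * (partial T).[x] - (padeP m k).[x]|
    <= 2 * padeS m k * `|x| ^+ (m.+1 + k).
Proof.
move=> km mkT x_le; rewrite -hornerM pade_eq // hornerD addrC addKr.
rewrite hornerM hornerXn normrM normrX ler_wpM2r ?exprn_ge0 //.
by apply: horner_le => // i; exact: pade_rem_coef_le.
Qed.

Lemma padeQ_le m k x : `|x| <= 1 -> `|(padeQ m k).[x]| <= padeS m k.
Proof.
move=> x_le; rewrite horner_poly; apply: le_trans (ler_norm_sum _ _ _) _.
by apply: ler_sum => j _; rewrite normrM normrX ler_piMr // exprn_ile1.
Qed.

Lemma padeQ0_neq0 m k : (padeQ m k)`_0 != 0.
Proof.
rewrite coef_poly /= /pade_q expr0 rising0 mul1r fact0 mul1r invr1 mul1r.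
rewrite gt_eqF // divr_gt0 ?ltr0n ?fact_gt0 // rising_gt0 //.
by rewrite ltr_wpDr.
Qed.

Lemma pade_det m k x : (k <= m)%N -> x != 0 ->
  (padeQ m.+1 k.+1).[x] * (padeP m k).[x]
    - (padeQ m k).[x] * (padeP m.+1 k.+1).[x] != 0.
Proof.
move=> km x0; pose T := (m + k + 4)%N.
have E1 := @pade_eq m k T km _; have E2 := @pade_eq m.+1 k.+1 T km _.
set W := padeQ m.+1 k.+1 * padeP m k - padeQ m k * padeP m.+1 k.+1.
rewrite -!hornerM -hornerN -hornerD -/W.
(* Eliminating [partial T] between the two Padé relations leaves only remainders; the second one
   starts two degrees later, whence ['X^2]. *)
pose V := padeQ m k * pade_rem m.+1 k.+1 T * 'X^2
  - padeQ m.+1 k.+1 * pade_rem m k T.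
have WV : W = V * 'X^(m.+1 + k).
  rewrite /W.
  have -> : padeP m k = padeQ m k * partial T - pade_rem m k T * 'X^(m.+1 + k).
    by rewrite E1 ?addrK // /T; lia.
  have E3 : padeP m.+1 k.+1 = padeQ m.+1 k.+1 * partial T
      - pade_rem m.+1 k.+1 T * ('X^2 * 'X^(m.+1 + k)).
    rewrite -exprD E2 ?addnA.
      by rewrite !add2n -addSnnS addrK.
    by rewrite /T; lia.
  by rewrite E3 /V; ring.
have V0 : V`_0 != 0.
  rewrite coefB coefMXn /= sub0r oppr_eq0 coef0M mulf_neq0 ?padeQ0_neq0 //.
  by rewrite pade_rem_coef0 // /T; lia.
(* [W] has degree at most [m + k + 1] and is divisible by ['X^(m.+1 + k)], so the cofactor [V] is a
   constant, nonzero by [V0]. *)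
have sV : (size V <= 1)%N.
  have Vn0 : V != 0 by apply: contraNneq V0 => ->; rewrite coef0.
  have : (size W <= m + k + 2)%N.
    rewrite /W (leq_trans (size_polyD _ _)) // geq_max size_polyN.
    have sQ m' k' : (size (padeQ m' k') <= k'.+1)%N := size_poly _ _.
    have sP m' k' : (size (padeP m' k') <= m'.+1)%N := size_poly _ _.
    apply/andP; split; apply: leq_trans (size_polyMleq _ _) _.
      by rewrite -subn1 leq_subLR (leq_trans (leq_add (sQ _ _) (sP _ _))) //; lia.
    by rewrite -subn1 leq_subLR (leq_trans (leq_add (sQ _ _) (sP _ _))) //; lia.
  by rewrite WV size_mulXn //; lia.
rewrite WV (size1_polyC sV) hornerM hornerC hornerXn mulf_neq0 //.
exact: expf_neq0.
Qed.

End Pade.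

(** * Integrality *)

Section Integrality.
Variable R : archiRealFieldType.
Implicit Types r s u v E m k n j l : nat.

Lemma rising_frac r s n : (0 < s)%N ->
  s%:R ^+ n * rising (r%:R / s%:R : R) n = (\prod_(i < n) (r + i * s))%:R.
Proof.
move=> s0; elim: n => [|n IH]; first by rewrite rising0 big_ord0 mulr1.
rewrite risingSr big_ord_recr natrM -IH natrD natrM exprS /=.
by field; rewrite pnatr_eq0 -lt0n.
Qed.

Lemma fact_neq0 n : n`!%:R != 0 :> R.
Proof. by rewrite pnatr_eq0 -lt0n fact_gt0. Qed.

(** One factor [s ^ n] clears the denominators of the rising factorial, the other makes [n!] divide
    the resulting product. *)
Lemma int_rising_fact r s n : (0 < s)%N ->
  s%:R ^+ (2 * n) * (rising (r%:R / s%:R : R) n / n`!%:R) \is a Num.int.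
Proof.
move=> s0; have /dvdnP[c E] := fact_dvd_prog r n s0.
rewrite mul2n -addnn exprD -mulrA [X in _ * X]mulrA rising_frac // mulrA.
by rewrite -natrX -natrM E natrM mulfK ?fact_neq0 // natr_int.
Qed.

(** [n! / (x)_(n+1)] is, up to sign, the [n]-th difference of [1/x], which avoids
    its partial fraction expansion. *)
Lemma int_fact_rising u v E n : (0 < u)%N -> (0 < v)%N ->
  (forall i, (i <= n)%N -> (u + i * v %| E)%N) ->
  E%:R * (n`!%:R / rising (u%:R / v%:R : R) n.+1) \is a Num.int.
Proof.
move=> u0 v0; have v_neq0 : v%:R != 0 :> R by rewrite pnatr_eq0 -lt0n.
elim: n u u0 => [|n IH] u u0 H.
  have /dvdnP[c ->] := H 0%N isT.
  rewrite mul0n addn0 natrM fact0 risingSr rising0 mul1r addr0 mul1r invf_div.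
  by rewrite mulrA mulrAC mulfK ?pnatr_eq0 -?lt0n // -natrM natr_int.
have xE : u%:R / v%:R + 1 = (u + v)%:R / v%:R :> R by rewrite natrD; field.
have -> : E%:R * (n.+1`!%:R / rising (u%:R / v%:R) n.+2) =
   E%:R * (n`!%:R / rising (u%:R / v%:R) n.+1)
   - E%:R * (n`!%:R / rising ((u + v)%:R / v%:R) n.+1) :> R.
  rewrite -xE; have : 0 < u%:R / v%:R :> R by rewrite divr_gt0 ?ltr0n.
  move: (u%:R / v%:R) => x x0.
  rewrite factS natrM [rising x n.+2]risingSl [rising (x + 1) _]risingSr risingSl.
  have r0 : rising (x + 1) n != 0 by rewrite gt_eqF // rising_gt0 // addr_gt0.
  have z0 : x != 0 by rewrite gt_eqF.
  have z1 : x + 1 + n%:R != 0 by rewrite gt_eqF // ltr_wpDr // addr_gt0.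
  by rewrite -[n.+1%:R]natr1; field; rewrite z0 r0 z1.
rewrite rpredB // IH ?addn_gt0 ?u0 // => i ni; first by rewrite H // leqW.
by rewrite -addnA -mulSn H.
Qed.

Section Data.
Variables r s u v E : nat.
Hypotheses (r0 : (0 < r)%N) (s0 : (0 < s)%N) (u0 : (0 < u)%N) (v0 : (0 < v)%N).
Let al : R := r%:R / s%:R.
Let be : R := u%:R / v%:R.
Hypothesis al_be : al < be.

Let al_gt0 : 0 < al. Proof. by rewrite divr_gt0 ?ltr0n. Qed.

Lemma int_mu m l : (forall i, (i < m)%N -> (u + i * v %| E)%N) -> (l <= m)%N ->
  (s ^ (2 * m) * E)%:R * mu al be l \is a Num.int.
Proof.
move=> H; case: l => [|l] lm; first by rewrite /mu !rising0 divr1 mulr1 natr_int.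
(* With [n = l + 1], [mu_n] is [(al)_n / n!] times [n] times [l! / (be)_n]: powers of [s] handle the
   first factor and [E] the last. *)
have -> : (s ^ (2 * m) * E)%:R * mu al be l.+1 =
  (s ^ (2 * (m - l.+1)) * l.+1)%:R *
  (s%:R ^+ (2 * l.+1) * (rising al l.+1 / l.+1`!%:R)) *
  (E%:R * (l`!%:R / rising be l.+1)).
  rewrite -{1}(subnK lm) mulnDr expnD /mu factS !natrM !natrX.
  have rb : rising be l.+1 != 0 by rewrite gt_eqF // rising_gt0 // divr_gt0 ?ltr0n.
  by field; rewrite rb fact_neq0 nat1r pnatr_eq0.
apply: rpredM; first by apply: rpredM; [exact: natr_int | exact: int_rising_fact].
by apply: int_fact_rising => // i il; apply: H; apply: leq_trans lm.
Qed.

Lemma int_pade_q m k j : (k <= m)%N -> (j <= k)%N ->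
  (s ^ (2 * k) * v ^ (2 * k))%:R * pade_q al be m k j \is a Num.int.
Proof.
move=> km jk; rewrite /pade_q.
have -> : al + (m.+1 - j)%:R = (r + (m.+1 - j) * s)%:R / s%:R.
  by rewrite /al natrD natrM; field; rewrite pnatr_eq0 -lt0n.
have -> : be + m%:R = (u + m * v)%:R / v%:R.
  by rewrite /be natrD natrM; field; rewrite pnatr_eq0 -lt0n.
have := int_rising_fact (r + (m.+1 - j) * s) j s0.
have := int_rising_fact (u + m * v) (k - j) v0.
set A := rising _ (k - j) / _; set B := rising _ j / _ => HA HB.
have -> : (s ^ (2 * k) * v ^ (2 * k))%:R * ((-1) ^+ j * B * A) =
  (-1) ^+ j * (s ^ (2 * (k - j)) * v ^ (2 * j))%:R *
  (s%:R ^+ (2 * j) * B) * (v%:R ^+ (2 * (k - j)) * A).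
  have ek x : (x ^ (2 * k) = x ^ (2 * (k - j)) * x ^ (2 * j))%N.
    by rewrite -expnD; congr (_ ^ _)%N; lia.
  by rewrite !ek !natrM !natrX; ring.
apply: rpredM HA; apply: rpredM HB; apply: rpredM; last exact: natr_int.
by rewrite rpredX // rpredN1.
Qed.

Lemma int_pade_p m k N : (forall i, (i < m)%N -> (u + i * v %| E)%N) ->
  (k <= m)%N -> (N <= m)%N ->
  (s ^ (2 * k) * v ^ (2 * k) * (s ^ (2 * m) * E))%:R * pade_p al be m k N \is a Num.int.
Proof.
move=> H km Nm; rewrite /pade_p mulr_sumr rpred_sum // => j _.
rewrite natrM mulrACA; apply: rpredM; first by rewrite int_pade_q // -ltnS.
case: ifP => _; last by rewrite mulr0 rpred0.
by apply: int_mu => //; exact: leq_trans (leq_subr _ _) Nm.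
Qed.

(** At the integer [X] the quotient is the binomial coefficient ['C(X + n - 1, n)]. *)
Lemma rising_fact_le (x : R) X n : 0 < x -> x <= X%:R ->
  rising x n / n`!%:R <= 2 ^+ (X + n).
Proof.
move=> x0 xX; rewrite ler_pdivrMr ?ltr0n ?fact_gt0 //.
apply: le_trans (rising_le n x0 xX) _.
have -> : rising (X%:R : R) n = (\prod_(i < n) (X + i))%:R.
  by rewrite natr_prod; apply: eq_bigr => i _; rewrite natrD.
rewrite prod_addn_bin natrM ler_wpM2r // -natrX ler_nat.
by apply: leq_trans (bin_le_exp2 _ _) _; rewrite leq_exp2l // leq_subr.
Qed.

Lemma padeS_le m k : (k <= m)%N ->
  padeS al be m k <= 2 ^+ (r + u + 1 + 2 * m + 2 * k).
Proof.
move=> km.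
have H j : (j <= k)%N -> `|pade_q al be m k j| <= 2 ^+ (r + u + 1 + 2 * m + k).
  move=> jk; rewrite normrM [X in X * _]normrM normrX normrN1 expr1n mul1r.
  have frac_le x y : (0 < y)%N -> x%:R / y%:R <= x%:R :> R.
    by move=> y0; rewrite ler_pdivrMr ?ltr0n // ler_peMr // ler1n.
  have xa : 0 < al + (m.+1 - j)%:R by rewrite ltr_wpDr.
  have xb : 0 < be + m%:R by rewrite ltr_wpDr // (lt_trans al_gt0).
  have ha : al + (m.+1 - j)%:R <= (r + (m.+1 - j))%:R.
    by rewrite natrD lerD2r frac_le.
  have hb : be + m%:R <= (u + m)%:R by rewrite natrD lerD2r frac_le.
  rewrite !ger0_norm ?divr_ge0 //; [|by rewrite ltW // rising_gt0..].
  apply: le_trans (ler_pM _ _ (rising_fact_le j xa ha) (rising_fact_le (k - j) xb hb)) _.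
  - by rewrite divr_ge0 // ltW // rising_gt0.
  - by rewrite divr_ge0 // ltW // rising_gt0.
  by rewrite -exprD ler_weXn2l ?ler1n //; lia.
apply: le_trans (_ : \sum_(j < k.+1) 2 ^+ (r + u + 1 + 2 * m + k) <= _).
  by apply: ler_sum => j _; rewrite H // -ltnS.
(* The number of terms, [k + 1], is absorbed by a further [2 ^ k]. *)
rewrite sumr_const card_ord -[leLHS]mulr_natl.
have -> : (r + u + 1 + 2 * m + 2 * k = k + (r + u + 1 + 2 * m + k))%N by lia.
by rewrite [leRHS]exprD ler_wpM2r ?exprn_ge0 // -natrX ler_nat ltn_expl.
Qed.

(** * Integer linear forms at [a / b] *)

Variables (a b : R) (M : nat).
Hypotheses (a_int : a \is a Num.int) (b_int : b \is a Num.int).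
Hypotheses (a_neq0 : a != 0) (b_gt0 : 0 < b) (ab_le : `|a / b| <= 2^-1).
Hypothesis E_gt0 : (0 < E)%N.
Hypothesis E_dvd : forall i, (i < 2 * M)%N -> (u + i * v %| E)%N.

(** Independent of [k]: the exponent of [s] needed is [2 * k + 2 * (M + k)], at most [6 * M] for
    [k <= M]. *)
Definition common_den := (s ^ (6 * M) * v ^ (2 * M) * E)%N.
(** The bound of [padeS_le] at [m = M + k], made uniform over [k <= M]. *)
Definition coef_bound := (2 ^ (r + u + 1 + 6 * M))%N.
Definition form_q k : R := common_den%:R * b ^+ k * (padeQ al be (M + k) k).[a / b].
Definition form_p k : R :=
  common_den%:R * b ^+ (M + k) * (padeP al be (M + k) k).[a / b].

Lemma common_den_gt0 : (0 < common_den)%N.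
Proof. by rewrite !muln_gt0 !expn_gt0 s0 v0. Qed.

Let b_neq0 : b != 0. Proof. by rewrite gt_eqF. Qed.

Lemma int_homogenize (D : R) n (c : nat -> R) : (forall i, (i <= n)%N -> D * c i \is a Num.int) ->
  D * b ^+ n * (\poly_(i < n.+1) c i).[a / b] \is a Num.int.
Proof.
move=> H; rewrite horner_poly mulr_sumr rpred_sum // => i _.
have ni : (i <= n)%N by rewrite -ltnS.
have -> : D * b ^+ n * (c i * (a / b) ^+ i) = D * c i * (b ^+ (n - i) * a ^+ i).
  rewrite -{1}(subnK ni) exprD expr_div_n; field; exact: expf_neq0.
by apply: rpredM; [exact: H | apply: rpredM; exact: rpredX].
Qed.

Lemma common_den_dvd k : (k <= M)%N ->
  (s ^ (2 * k) * v ^ (2 * k) * (s ^ (2 * (M + k)) * E) %| common_den)%N.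
Proof.
move=> kM; rewrite mulnA /common_den dvdn_mul // mulnAC -expnD.
by rewrite dvdn_mul // dvdn_exp2l //; lia.
Qed.

Lemma int_form_q k : (k <= M)%N -> form_q k \is a Num.int.
Proof.
move=> kM; apply: int_homogenize => j jk.
have /dvdnP[c ->] : (s ^ (2 * k) * v ^ (2 * k) %| common_den)%N.
  by apply: dvdn_trans (common_den_dvd kM); exact: dvdn_mulr.
rewrite natrM -mulrA; apply: rpredM; first exact: natr_int.
by rewrite int_pade_q // leq_addl.
Qed.

Lemma int_form_p k : (k <= M)%N -> form_p k \is a Num.int.
Proof.
move=> kM; apply: int_homogenize => j jk.
have /dvdnP[c ->] := common_den_dvd kM.
rewrite natrM -mulrA; apply: rpredM; first exact: natr_int.
by apply: int_pade_p => // [i iM|]; [apply: E_dvd; lia | exact: leq_addl].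
Qed.

Lemma padeS_le_bound k : (k <= M)%N -> padeS al be (M + k) k <= coef_bound%:R.
Proof.
move=> kM; apply: le_trans (padeS_le (leq_addl _ _)) _.
by rewrite natrX ler_weXn2l ?ler1n //; lia.
Qed.

Lemma form_q_le k : (k <= M)%N ->
  `|form_q k| <= (common_den * coef_bound)%:R * b ^+ k.
Proof.
move=> kM; rewrite normrM ger0_norm ?mulr_ge0 ?exprn_ge0 ?(ltW b_gt0) //.
rewrite natrM mulrAC ler_wpM2r ?exprn_ge0 ?(ltW b_gt0) // ler_wpM2l //.
apply: le_trans (padeS_le_bound kM); apply: padeQ_le => //.
by apply: le_trans ab_le _; lra.
Qed.

Lemma form_remainder k T : (k <= M)%N -> (M + k + k < T)%N ->
  `|b ^+ M * form_q k * (\sum_(i < T) mu al be i * (a / b) ^+ i) - form_p k|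
     * b ^+ k.+1
  <= (2 * common_den * coef_bound)%:R * `|a| ^+ (M + k + k).+1.
Proof.
move=> kM kT; rewrite /form_q /form_p -horner_poly -/(partial al be T).
have := pade_remainder al_gt0 al_be (leq_addl M k) kT ab_le.
set Q := _.[_]; set F := _.[_]; set P := _.[_] => H.
have -> : b ^+ M * (common_den%:R * b ^+ k * Q) * F
    - common_den%:R * b ^+ (M + k) * P
  = common_den%:R * b ^+ (M + k) * (Q * F - P) by rewrite exprD; ring.
rewrite normrM ger0_norm ?mulr_ge0 ?exprn_ge0 ?(ltW b_gt0) //.
have H2 : `|Q * F - P| <= 2 * coef_bound%:R * (`|a| / b) ^+ ((M + k).+1 + k).
  apply: le_trans H _; rewrite normrM normfV (gtr0_norm b_gt0).
  by rewrite ler_wpM2r ?exprn_ge0 ?divr_ge0 ?(ltW b_gt0) // ler_wpM2l // padeS_le_bound.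
(* The powers of [b] cancel exactly: [(M + k) + (k + 1) = M + 2 k + 1]. *)
have -> : (2 * common_den * coef_bound)%:R * `|a| ^+ (M + k + k).+1 =
  common_den%:R * b ^+ (M + k) *
    (2 * coef_bound%:R * (`|a| / b) ^+ ((M + k).+1 + k)) * b ^+ k.+1.
  have -> : ((M + k).+1 + k = (M + k + k).+1)%N by [].
  have e : b ^+ (M + k) * b ^+ k.+1 = b ^+ (M + k + k).+1 by rewrite -exprD addnS.
  rewrite [RHS]mulrAC -[_ * b ^+ _ * b ^+ _]mulrA e expr_div_n !natrM.
  by field; exact: expf_neq0.
rewrite ler_wpM2r ?exprn_ge0 ?(ltW b_gt0) // ler_wpM2l //.
by rewrite mulr_ge0 ?exprn_ge0 ?(ltW b_gt0).
Qed.

Lemma form_det k : form_q k.+1 * form_p k - form_q k * form_p k.+1 != 0.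
Proof.
have := pade_det al_gt0 al_be (leq_addl M k) (mulf_neq0 a_neq0 (invr_neq0 b_neq0)).
rewrite /form_q /form_p addnS => H.
set Q := _.[_] in H *; set P := _.[_] in H; set Q' := _.[_] in H *.
set P' := _.[_] in H; rewrite -/P -/P'.
have -> : common_den%:R * b ^+ k.+1 * Q * (common_den%:R * b ^+ (M + k) * P)
  - common_den%:R * b ^+ k * Q' * (common_den%:R * b ^+ (M + k).+1 * P') =
  common_den%:R * common_den%:R * b ^+ k.+1 * b ^+ (M + k) * (Q * P - Q' * P').
  by rewrite !exprS; ring.
have D0 : common_den%:R != 0 :> R by rewrite pnatr_eq0 -lt0n common_den_gt0.
by rewrite !mulf_neq0 // expf_neq0.
Qed.

End Data.
End Integrality.

(** * Transfer to the standard real numbers and integers *)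

Lemma pochE (x : R) n : poch x n = rising x n.
Proof. by elim: n => [|n IH]; rewrite ?rising0 // risingSr /= IH INRE. Qed.

Lemma hyper_sumE (al be x : R) T :
  hyper_sum al be x T = \sum_(i < T.+1) mu al be i * x ^+ i.
Proof.
rewrite /hyper_sum RealsE big_mkord; apply: eq_bigr => i _.
by rewrite /mu !pochE RpowE.
Qed.

Lemma IZR_int z : IZR z \is a Num.int.
Proof.
case: (Z_le_gt_dec Z0 z) => z0.
  by rewrite -(Z2Nat.id z) // -INR_IZR_INZ INRE natr_int.
rewrite -[z]Z.opp_involutive opp_IZR -(Z2Nat.id (Z.opp z)); last by lia.
by rewrite -INR_IZR_INZ INRE rpredN natr_int.
Qed.

Lemma int_IZR (x : R) : x \is a Num.int -> exists z, x = IZR z.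
Proof.
case/intrP => - [] n ->.
  by exists (Z.of_nat n); rewrite -INR_IZR_INZ INRE.
by exists (Z.opp (Z.of_nat n.+1)); rewrite opp_IZR -INR_IZR_INZ INRE.
Qed.

Lemma approx_forms r s u v E M k (a b : Z) :
  (0 < r)%N -> (0 < s)%N -> (0 < u)%N -> (0 < v)%N ->
  Rlt (INR r / INR s) (INR u / INR v) ->
  a <> Z0 -> Rlt 0 (IZR b) -> Rle (Rabs (IZR a / IZR b)) (/ 2) ->
  (0 < E)%N -> (forall i, (i < 2 * M)%N -> (u + i * v %| E)%N) -> (k < M)%N ->
  exists q p q' p' : Z,
    let F := approx_form (INR r / INR s) (INR u / INR v) a b
      (INR (common_den s v E M * coef_bound r u M)) M in
    [/\ F k q p, F k.+1 q' p' & Z.mul q' p <> Z.mul q p'].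
Proof.
move=> r0 s0 u0 v0 lt_ab0 a0 b0 ab E0 HE kM.
have lt_ab : r%:R / s%:R < u%:R / v%:R :> R by rewrite -!INRE; apply/RltP.
have ab' : `|(IZR a : R) / IZR b| <= 2^-1 by rewrite -RabsE; apply/RleP.
have a_neq0 : (IZR a : R) != 0 by apply/eqP; exact: not_0_IZR.
move/RltP: b0 => b0.
have ai := IZR_int a; have bi := IZR_int b.
pose fq := @form_q R r s u v E (IZR a) (IZR b) M.
pose fp := @form_p R r s u v E (IZR a) (IZR b) M.
have H l q p : (l <= M)%N -> fq l = IZR q -> fp l = IZR p ->
    approx_form (INR r / INR s) (INR u / INR v) a b
      (INR (common_den s v E M * coef_bound r u M)) M l q p.
  move=> lM Eq Ep; split.
    apply/RleP; rewrite -Eq RabsE RpowE INRE; exact: form_q_le.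
  move=> T /ssrnat.leP MT; apply/RleP.
  rewrite -Eq -Ep RabsE !RpowE !INRE hyper_sumE.
  have := @form_remainder R r s u v E r0 s0 u0 v0 lt_ab (IZR a) (IZR b) M
    ai bi a_neq0 b0 ab' E0 l T.+1 lM MT.
  by rewrite -mulnA natrM RabsE; apply.
have [q Eq] : exists q, fq k = IZR q.
  by apply: int_IZR; apply: int_form_q => //; exact: ltnW.
have [p Ep] : exists p, fp k = IZR p.
  by apply: int_IZR; apply: int_form_p => //; exact: ltnW.
have [q' Eq'] : exists q', fq k.+1 = IZR q'.
  by apply: int_IZR; apply: int_form_q.
have [p' Ep'] : exists p', fp k.+1 = IZR p'.
  by apply: int_IZR; apply: int_form_p.
exists q, p, q', p'; split; [by apply: H => //; exact: ltnW | exact: H |].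
have : fq k.+1 * fp k - fq k * fp k.+1 != 0 by apply: form_det.
rewrite Eq Ep Eq' Ep' => /eqP nz E'; apply: nz.
by rewrite -[_ * _]mult_IZR -[X in _ - X]mult_IZR E' subrr.
Qed.

Lemma power_lcm_dvd u v M : (0 < u)%N -> forall i, (i < 2 * M)%N ->
  (u + i * v %| power_lcm (u + 2 * M * v))%N.
Proof.
move=> u0 i iM; apply: dvdn_power_lcm; first by rewrite addn_gt0 u0.
by rewrite leq_add2l leq_mul2r ltnW ?orbT.
Qed.

(** The algebraic result restated over the standard library types, with [E] chosen as [power_lcm N].
    One [C] serves both [k] and [k + 1]. *)
Lemma integer_pade_forms r s u v M k (a b : Z) :
  Peano.lt 0 r -> Peano.lt 0 s -> Peano.lt 0 u -> Peano.lt 0 v ->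
  Rlt (INR r / INR s) (INR u / INR v) ->
  a <> Z0 -> Rlt 0 (IZR b) -> Rle (Rabs (IZR a / IZR b)) (/ 2) -> Peano.lt k M ->
  exists (C : R) (q p q' p' : Z),
    let N := Nat.add u (Nat.mul (Nat.mul 2 M) v) in
    let F := approx_form (INR r / INR s) (INR u / INR v) a b C M in
    Rlt 0 C /\
    Rle C (INR s ^ Nat.mul 6 M * INR v ^ Nat.mul 2 M *
           INR N ^ count_primes N * 2 ^ Nat.add (Nat.add (Nat.add r u) 1) (Nat.mul 6 M)) /\
    F k q p /\ F k.+1 q' p' /\ Z.mul q' p <> Z.mul q p'.
Proof.
move=> /ssrnat.ltP r0 /ssrnat.ltP s0 /ssrnat.ltP u0 /ssrnat.ltP v0.
move=> lt_ab a0 b0 ab /ssrnat.ltP kM; pose N := (u + 2 * M * v)%N.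
have [q [p [q' [p' [Fq Fq' det]]]]] := approx_forms r0 s0 u0 v0 lt_ab a0 b0 ab
  (power_lcm_gt0 N) (power_lcm_dvd v u0) kM.
exists (INR (common_den s v (power_lcm N) M * coef_bound r u M)), q, p, q', p'.
split; [|split; [|by split]].
  rewrite INRE; apply/RltP.
  by rewrite ltr0n muln_gt0 common_den_gt0 ?power_lcm_gt0 // expn_gt0.
apply/RleP; rewrite !RpowE !INRE !RmultE.
have -> : (2 : R) = 2%:R by rewrite -INRE.
rewrite -!natrX -!natrM ler_nat /common_den /coef_bound.
by rewrite leq_mul2r leq_mul2l power_lcm_le ?orbT // addn_gt0 u0.
Qed.

End HypergeometricPade.

(** * Analytic estimates *)

Lemma poch_gt0 x n : 0 < x -> 0 < poch x n.
Proof.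
  intros Hx; induction n as [|n IH]; simpl; [lra|].
  apply Rmult_lt_0_compat; [exact IH|pose proof (pos_INR n); lra].
Qed.

Lemma poch_le x y n : 0 < x -> x <= y -> poch x n <= poch y n.
Proof.
  intros Hx Hxy; induction n as [|n IH]; simpl; [lra|].
  pose proof (pos_INR n); pose proof (poch_gt0 x n Hx).
  apply Rmult_le_compat; lra.
Qed.

(** Comparison with the geometric series, as the coefficients lie in [[0, 1]]. *)
Lemma hyper_cv al be x : 0 < al -> al <= be -> Rabs x < 1 ->
  exists phi, infinite_sum (fun k => poch al k / poch be k * x ^ k) phi.
Proof.
  intros Hal Hbe Hx.
  assert (H : {l | Un_cv (fun N => sum_f_R0 (fun k => poch al k / poch be k * x ^ k) N) l}).
  { apply cv_cauchy_2, cauchy_abs, cv_cauchy_1.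
    apply Rseries_CV_comp with (Bn := fun k => 1 * Rabs x ^ k).
    - intros n; rewrite Rabs_mult, RPow_abs.
      pose proof (Rabs_pos (x ^ n)).
      pose proof (poch_gt0 be n ltac:(lra)); pose proof (poch_gt0 al n Hal).
      rewrite (Rabs_pos_eq (poch al n / poch be n)).
      2: { apply Rlt_le, Rdiv_lt_0_compat; assumption. }
      assert (poch al n / poch be n <= 1).
      { apply Rmult_le_reg_r with (poch be n); [assumption|].
        unfold Rdiv; rewrite Rmult_assoc, Rinv_l, Rmult_1_r, Rmult_1_l by lra.
        apply poch_le; assumption. }
      assert (0 <= poch al n / poch be n) by (apply Rlt_le, Rdiv_lt_0_compat; assumption).
      split; [apply Rmult_le_pos; assumption|].
      apply Rmult_le_compat_r; assumption.
    - exists (/ (1 - Rabs x)).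
      apply (GP_infinite (Rabs x)); rewrite Rabs_Rabsolu; exact Hx. }
  destruct H as [phi H]; exists phi; exact H.
Qed.

(** From [x <= (1 + x / 4) ^ 2 <= exp (x / 4) ^ 2], where the first inequality is
    [(1 - x / 4) ^ 2 >= 0]. *)
Lemma ln_le_half x : 0 < x -> ln x <= x / 2.
Proof.
  intros Hx; replace x with ((x / 4 * 4)) at 1 by field.
  pose proof (exp_ineq1_le (x / 4)) as H.
  rewrite <- (ln_exp (x / 2)); replace (x / 2) with (x / 4 + x / 4) by field.
  rewrite exp_plus.
  assert (x <= exp (x / 4) * exp (x / 4)).
  { assert ((1 + x / 4) * (1 + x / 4) <= exp (x / 4) * exp (x / 4))
      by (apply Rmult_le_compat; lra).
    pose proof (Rle_0_sqr (1 - x / 4)) as Hs; unfold Rsqr in Hs; nra. }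
  replace (x / 4 * 4) with x by field.
  destruct (Rle_lt_or_eq_dec _ _ H0) as [Hlt|Heq].
  - apply Rlt_le, ln_increasing; assumption.
  - rewrite <- Heq; lra.
Qed.

Lemma ln_le x y : 0 < x -> x <= y -> ln x <= ln y.
Proof.
  intros Hx [H| ->]; [apply Rlt_le, ln_increasing; assumption|lra].
Qed.

Lemma ln_le_inv x y : 0 < x -> 0 < y -> ln x <= ln y -> x <= y.
Proof.
  intros Hx Hy H; apply Rnot_lt_le; intros Hlt.
  pose proof (ln_increasing _ _ Hy Hlt); lra.
Qed.

Lemma ln_ge0 x : 1 <= x -> 0 <= ln x.
Proof. intros H; rewrite <- ln_1; apply ln_le; lra. Qed.

Lemma Rpower_ge1 x y : 1 <= x -> 0 <= y -> 1 <= Rpower x y.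
Proof.
  intros Hx Hy; unfold Rpower; rewrite <- exp_0 at 1.
  pose proof (Rmult_le_pos _ _ Hy (ln_ge0 x Hx)) as [H| <-]; [|lra].
  apply Rlt_le, exp_increasing, H.
Qed.

Lemma INR_ge1 n : (1 <= n)%nat -> 1 <= INR n.
Proof. intros H; apply (le_INR 1); exact H. Qed.

Lemma epsilon_ge1 n : 1 <= epsilon n.
Proof.
  unfold epsilon; generalize n at 2; intros k; induction k as [|k IH];
    cbn [eps_aux]; [lra|].
  rewrite <- (Rmult_1_r 1); apply Rmult_le_compat; try lra.
  destruct (andb _ _); [|lra].
  destruct k as [|k].
  (* At the index [1] the exponent is a division by zero, but the base [1] gives the value [1]
     whatever the exponent. *)
  - change (INR 1) with 1; unfold Rpower; rewrite ln_1, Rmult_0_r, exp_0; lra.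
  - apply Rpower_ge1; [apply INR_ge1; lia|].
    pose proof (INR_ge1 (S k) ltac:(lia)); rewrite S_INR.
    apply Rlt_le, Rdiv_lt_0_compat; lra.
Qed.

Lemma reduced_sum r0 s0 r s :
  (0 < r0)%nat -> (0 < s0)%nat -> (0 < r)%nat -> (0 < s)%nat ->
  (0 < u_of r0 s0 r s)%nat /\ (0 < v_of r0 s0 r s)%nat /\
  (0 < d_of r0 s0 r s)%nat /\ (0 < dt_of r0 s0 r s)%nat /\
  INR r / INR s + INR r0 / INR s0 = INR (u_of r0 s0 r s) / INR (v_of r0 s0 r s).
Proof.
  intros Hr0 Hs0 Hr Hs.
  (* Two product equations replace the integer divisions; the same [g] then turns out to be [d]. *)
  assert (Hg : exists g, (0 < g)%nat /\ num_sum r0 s0 r s = (u_of r0 s0 r s * g)%nat /\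
      (s0 * s = v_of r0 s0 r s * g)%nat).
  { exists (gsum r0 s0 r s); unfold u_of, v_of, gsum, num_sum.
    set (x := (r0 * s + r * s0)%nat); set (y := (s0 * s)%nat).
    assert (Hy : (0 < y)%nat) by (unfold y; nia).
    destruct (Nat.gcd_divide_l x y) as [c Hc]; destruct (Nat.gcd_divide_r x y) as [e He].
    assert (Hg : Nat.gcd x y <> 0%nat) by (intros H; rewrite H, Nat.mul_0_r in He; lia).
    repeat split; [apply Nat.neq_0_lt_0, Hg| |].
    - rewrite Hc at 1 2; rewrite Nat.div_mul by exact Hg; reflexivity.
    - rewrite He at 1 2; rewrite Nat.div_mul by exact Hg; reflexivity. }
  destruct Hg as [g [Hg [Hu Hv]]].
  assert (Hd : d_of r0 s0 r s = g).
  { unfold d_of; rewrite Hv at 1; rewrite Nat.mul_comm, Nat.div_mul; [reflexivity|nia]. }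
  unfold dt_of; rewrite Hd; unfold num_sum in Hu.
  set (u := u_of r0 s0 r s) in *; set (v := v_of r0 s0 r s) in *.
  assert (0 < v)%nat by nia.
  assert (0 < u)%nat by nia.
  repeat split; [assumption|assumption|assumption| |].
  - apply Nat.div_str_pos.
    pose proof (Nat.gcd_divide_l g s0) as Hdiv; split.
    + apply Nat.neq_0_lt_0; intros H0'; rewrite H0' in Hdiv.
      apply Nat.divide_0_l in Hdiv; lia.
    + apply Nat.divide_pos_le; assumption.
  - apply (f_equal INR) in Hu; apply (f_equal INR) in Hv.
    rewrite plus_INR, !mult_INR in Hu; rewrite !mult_INR in Hv.
    apply lt_0_INR in Hr0, Hs0, Hr, Hs, Hg; assert (0 < INR v) by (apply lt_0_INR; assumption).
    apply Rmult_eq_reg_r with (INR s0 * INR s); [|nra].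
    transitivity (INR r0 * INR s + INR r * INR s0); [field; lra|].
    rewrite Hu, Hv; field; lra.
Qed.

Lemma prime_pi_INR n : prime_pi (INR n) = count_primes n.
Proof. unfold prime_pi; rewrite Int_part_INR, Nat2Z.id; reflexivity. Qed.

Lemma approx_form_limit al be a b C M k q p phi :
  approx_form al be a b C M k q p -> 0 <= IZR b ->
  infinite_sum (fun i => poch al i / poch be i * (IZR a / IZR b) ^ i) phi ->
  Rabs (IZR b ^ M * IZR q * phi - IZR p) * IZR b ^ S k
    <= 2 * C * Rabs (IZR a) ^ S (M + k + k).
Proof.
  intros [_ HT] Hb Hphi; apply Rnot_lt_le; intros Hlt.
  set (Y := IZR b ^ M * IZR q) in *; set (bk := IZR b ^ S k) in *.
  set (rhs := 2 * C * _) in *.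
  assert (Hbk : 0 <= bk) by (apply pow_le, Hb).
  (* [gap] is the supposed excess over the bound; a partial sum within [gap / (Rabs Y * bk + 1)] of
     [phi] would already exceed it. The [+ 1] keeps the divisor positive even if [Y] vanishes. *)
  set (gap := Rabs (Y * phi - IZR p) * bk - rhs).
  assert (Hw : 0 < Rabs Y * bk + 1)
    by (pose proof (Rmult_le_pos _ _ (Rabs_pos Y) Hbk); lra).
  destruct (Hphi (gap / (Rabs Y * bk + 1))) as [N HN].
  { apply Rdiv_lt_0_compat; unfold gap; lra. }
  specialize (HN (N + (M + k + k))%nat ltac:(lia)).
  specialize (HT (N + (M + k + k))%nat ltac:(lia)).
  fold (hyper_sum al be (IZR a / IZR b) (N + (M + k + k))) in HN.
  set (h := hyper_sum _ _ _ _) in *; unfold Rdist in HN.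
  assert (H1 : Rabs (Y * phi - IZR p) <= Rabs (Y * h - IZR p) + Rabs Y * Rabs (h - phi)).
  { replace (Y * phi - IZR p) with ((Y * h - IZR p) + Y * (- (h - phi))) by ring.
    eapply Rle_trans; [apply Rabs_triang|].
    rewrite Rabs_mult, Rabs_Ropp; lra. }
  assert (H2 : Rabs (h - phi) * (Rabs Y * bk + 1) < gap).
  { apply Rmult_lt_reg_r with (/ (Rabs Y * bk + 1)); [apply Rinv_0_lt_compat, Hw|].
    rewrite Rmult_assoc, Rinv_r, Rmult_1_r by lra; exact HN. }
  pose proof (Rmult_le_compat_r bk _ _ Hbk H1) as H3.
  pose proof (Rabs_pos (h - phi)).
  unfold gap in H2; nra.
Qed.

(** The nonzero integer [q n - B p] equals [B Lam - B b^M q delta]. The first term is at most [1/2]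
    in absolute value, so the second is at least [1/2], while [|q| <= G / 2]. *)
Lemma gap_of_form (a b B n q p : Z) C G phi (M k : nat) :
  0 < IZR b -> 0 < IZR B -> 0 < G -> (q * n)%Z <> (B * p)%Z ->
  Rabs (IZR q) <= C * IZR b ^ k ->
  Rabs (IZR b ^ M * IZR q * phi - IZR p) * IZR b ^ S k
    <= 2 * C * Rabs (IZR a) ^ S (M + k + k) ->
  4 * IZR B * C * Rabs (IZR a) ^ S (M + k + k) <= IZR b ^ S k ->
  2 * C * IZR b ^ k <= G ->
  1 / (IZR B * IZR b ^ M * G) <= Rabs (phi - IZR n / (IZR B * IZR b ^ M)).
Proof.
  intros Hb HB HG Hne Hq Hform Hsmall HCG.
  assert (HbM : 0 < IZR b ^ M) by (apply pow_lt, Hb).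
  assert (Hbk : 0 < IZR b ^ S k) by (apply pow_lt, Hb).
  set (bM := IZR b ^ M) in *; set (bk := IZR b ^ S k) in *.
  set (A := Rabs (IZR a) ^ S (M + k + k)) in *.
  set (delta := phi - IZR n / (IZR B * bM)).
  set (Lam := bM * IZR q * phi - IZR p) in *.
  assert (Hid : IZR (q * n - B * p) = IZR B * Lam - IZR B * bM * IZR q * delta).
  { rewrite minus_IZR, !mult_IZR; unfold Lam, delta; field; lra. }
  assert (H1 : 1 <= Rabs (IZR (q * n - B * p))).
  { rewrite <- abs_IZR; apply IZR_le; lia. }
  assert (H2 : IZR B * Rabs Lam <= / 2).
  { apply Rmult_le_reg_r with bk; [exact Hbk|].
    pose proof (Rmult_le_compat_l (IZR B) _ _ (Rlt_le _ _ HB) Hform); nra. }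
  assert (H3 : Rabs (IZR (q * n - B * p)) <=
      IZR B * Rabs Lam + IZR B * bM * (Rabs (IZR q) * Rabs delta)).
  { rewrite Hid; unfold Rminus; eapply Rle_trans; [apply Rabs_triang|].
    rewrite Rabs_Ropp, !Rabs_mult, (Rabs_pos_eq (IZR B)), (Rabs_pos_eq bM) by lra; lra. }
  assert (H4 : Rabs (IZR q) * Rabs delta <= G / 2 * Rabs delta).
  { apply Rmult_le_compat_r; [apply Rabs_pos|lra]. }
  assert (HP : 0 < IZR B * bM) by (apply Rmult_lt_0_compat; assumption).
  pose proof (Rmult_le_compat_l _ _ _ (Rlt_le _ _ HP) H4) as H5.
  apply Rmult_le_reg_r with (IZR B * bM * G); [apply Rmult_lt_0_compat; assumption|].
  unfold Rdiv; rewrite Rmult_assoc, Rinv_l, Rmult_1_r by nra.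
  nra.
Qed.

Lemma nat_floor x : 0 <= x -> exists n, INR n <= x < INR n + 1.
Proof.
  intros Hx; destruct (archimed x) as [H1 H2].
  assert (Hz : (0 < up x)%Z) by (apply lt_IZR; lra).
  exists (Z.to_nat (up x - 1)).
  rewrite INR_IZR_INZ, Z2Nat.id, minus_IZR by lia; lra.
Qed.

(** The letters [la1, la2, la, lb, lB, lC] stand for the logarithms of
    [a1, a2, |a|, b, B, C]; the summands [2] and [1] bound [ln 4] and [ln 2]. *)
Lemma log_estimates (r0 s0 r s u v theta t la1 la2 la lb lB lC M j : R) :
  1 <= r0 -> 1 <= s0 -> 1 <= r -> 1 <= s -> 1 <= u -> 1 <= v -> 1 < theta ->
  theta * (s0 / 2 + s + 2 * v) <= la1 ->
  theta * (r + s + 2 * r0 + 2 * u) <= la2 ->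
  0 <= la -> 0 <= M -> j <= M ->
  6 * (la2 + la) + lb / 2 <= M * (la1 + la) ->
  (4 * t + 1) / 2 * lb <= M * (la1 + la) ->
  5 / 2 * lb <= M * (la1 + la) ->
  0 <= lb -> lB <= t * lb ->
  lC <= 6 * M * (s / 2) + 2 * M * (v / 2) + theta * (u + 2 * M * v) + (r + u + 1 + 6 * M) ->
  6 * M * (la1 + la) - lb <= (j + 1) * lb ->
  j * lb <= 6 * M * (la1 + la) ->
  2 + lB + lC + (M + 2 * j + 1) * la <= (j + 1) * lb /\
  1 + lC + j * lb <= M * (18 * la1 + 17 * la).
Proof.
  intros Hr0 Hs0 Hr Hs Hu Hv Hth H1 H2 Hla HM Hj Ha2 Ht H52 Hlb HB HC Hlo Hhi.
  (* [E1] collects the coefficient of [M] in the bound for [lC], [E2] the rest: together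
     [lC + 2 <= 4 M la1 + la2]. The first conclusion then needs
     [t lb + la2 + la + lb <= 2 M la1 + 3 M la], and the three lower bounds for [M (la1 + la)] give
     the left side at most [(1/2 + 1/6 + 4/15) M (la1 + la)]. *)
  assert (E1 : 3 * s + v + 2 * theta * v + 6 <= 4 * la1) by nra.
  assert (E2 : r + u + theta * u + 3 <= la2) by nra.
  assert (E3 : M * (3 * s + v + 2 * theta * v + 6) <= M * (4 * la1))
    by (apply Rmult_le_compat_l; assumption).
  assert (E4 : j * la <= M * la) by (apply Rmult_le_compat_r; assumption).
  assert (E5 : 0 <= M * la) by (apply Rmult_le_pos; assumption).
  assert (E6 : 0 <= M * la1) by (apply Rmult_le_pos; nra).
  split; nra.
Qed.

Theorem theorem4
  (r0 s0 r s : nat)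
  (Hr0 : (0 < r0)%nat) (Hs0 : (0 < s0)%nat) (Hr : (0 < r)%nat) (Hs : (0 < s)%nat)
  (Hcop0 : Nat.gcd r0 s0 = 1%nat) (Hcop : Nat.gcd r s = 1%nat)
  (theta vth : R) (Htheta : 1 < theta) (Hvth : 1 < vth)
  (ctheta : R) (Hct2 : 2 <= ctheta)
  (Hct : forall x : R, ctheta <= x -> INR (prime_pi x) <= theta * x / ln x)
  (cvth : R) (Hcv0 : 0 < cvth)
  (Hcv : forall n : nat, cvth <= INR n -> (INR n + 1) ^ 2 < vth ^ n)
  (a b B : Z) (Ha : a <> 0%Z) (Hb : (1 <= b)%Z) (HB : (1 <= B)%Z)
  (t : R) (Ht : 0 <= t)
  (Hb6 : (a1_of r0 s0 r s theta vth * Rabs (IZR a)) ^ 6 <= IZR b)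
  (HBt : IZR B <= Rpower (IZR b) t) :
  let alpha0 := INR r0 / INR s0 in
  let alpha := INR r / INR s in
  let a1 := a1_of r0 s0 r s theta vth in
  let a2 := a2_of r0 s0 r s theta in
  let L := ln (IZR b) / ln (a1 * Rabs (IZR a)) in
  let M0 := L * Rmax (Rmax (6 * ln (a2 * Rabs (IZR a)) / ln (IZR b) + 1/2)
                           ((4 * t + 1) / 2))
                     (Rmax (1/4 * L)
                           ((1 + Rmax (Rmax ctheta cvth) 4) / 2)) in
  exists phi : R,
    infinite_sum
      (fun k => poch alpha k / poch (alpha + alpha0) k * (IZR a / IZR b) ^ k) phi /\
    forall (n : Z) (M : nat), M0 <= INR M ->
      Rabs (phi - IZR n / (IZR B * IZR b ^ M))
        >= 1 / (IZR B * IZR b ^ M * (a1 ^ 18 * Rabs (IZR a) ^ 17) ^ M).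
Proof.
  intros alpha0 alpha a1 a2 L M0.
  destruct (reduced_sum r0 s0 r s Hr0 Hs0 Hr Hs) as [Hu [Hv [Hd [Hdt Hsum]]]].
  unfold alpha0, alpha in *; clear alpha0 alpha; rewrite Hsum.
  assert (Hlt : INR r / INR s < INR (u_of r0 s0 r s) / INR (v_of r0 s0 r s)).
  { rewrite <- Hsum; apply lt_0_INR in Hr0, Hs0.
    pose proof (Rdiv_lt_0_compat _ _ Hr0 Hs0); lra. }
  assert (Hal : 0 < INR r / INR s) by (apply Rdiv_lt_0_compat; apply lt_0_INR; assumption).
  (* All other factors of [a1] are at least [1]; likewise for [a2] below. *)
  assert (Ha1 : exp (theta * (INR s0 / 2 + INR s + 2 * INR (v_of r0 s0 r s))) <= a1).
  { unfold a1, a1_of; rewrite <- (Rmult_1_l (exp _)) at 1.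
    apply Rmult_le_compat_r; [apply Rlt_le, exp_pos|].
    pose proof (epsilon_ge1 s) as Es; pose proof (epsilon_ge1 s0) as Es0.
    pose proof (epsilon_ge1 (v_of r0 s0 r s)) as Ev.
    pose proof (INR_ge1 _ Hd) as Id; pose proof (INR_ge1 _ Hs0) as Is0.
    pose proof (INR_ge1 _ Hdt) as Idt.
    assert (mul1 : forall x y, 1 <= x -> 1 <= y -> 1 <= x * y) by (intros; nra).
    apply mul1; [apply mul1|exact Es]; [|exact Idt].
    apply Rpower_ge1; [repeat apply mul1; lra|lra]. }
  assert (Ha2 : exp (theta * (INR r + INR s + 2 * INR r0 + 2 * INR (u_of r0 s0 r s))) <= a2).
  { unfold a2, a2_of; rewrite <- (Rmult_1_l (exp _)) at 1.
    apply Rmult_le_compat_r; [apply Rlt_le, exp_pos|].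
    pose proof (epsilon_ge1 s) as Es; pose proof (INR_ge1 _ Hdt) as Idt; nra. }
  fold a1 in Hb6.
  clearbody a1 a2; clear Hd Hdt Hcop Hcop0 Hsum.
  set (u := u_of r0 s0 r s) in *; set (v := v_of r0 s0 r s) in *; clearbody u v.
  apply INR_ge1 in Hr0 as Ir0; apply INR_ge1 in Hs0 as Is0.
  apply INR_ge1 in Hr as Ir; apply INR_ge1 in Hs as Is.
  apply INR_ge1 in Hu as Iu; apply INR_ge1 in Hv as Iv.
  assert (Ea : 1 <= Rabs (IZR a)) by (rewrite <- abs_IZR; apply IZR_le; lia).
  assert (Pa1 : 0 < a1) by (eapply Rlt_le_trans; [apply exp_pos|exact Ha1]).
  assert (Pa2 : 0 < a2) by (eapply Rlt_le_trans; [apply exp_pos|exact Ha2]).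
  apply ln_le in Ha1; [|apply exp_pos]; apply ln_le in Ha2; [|apply exp_pos].
  rewrite ln_exp in Ha1, Ha2.
  set (X := a1 * Rabs (IZR a)) in *.
  assert (PX : 0 < X) by (apply Rmult_lt_0_compat; lra).
  assert (lnX : ln X = ln a1 + ln (Rabs (IZR a))) by (apply ln_mult; lra).
  pose proof (ln_ge0 _ Ea) as La.
  assert (La1 : 3 < ln a1) by nra.
  assert (Pb : 0 < IZR b) by (apply (IZR_lt 0); lia).
  assert (PB : 0 < IZR B) by (apply (IZR_lt 0); lia).
  assert (L6 : 6 * ln X <= ln (IZR b)).
  { replace (6 * ln X) with (ln (X ^ 6)) by (rewrite ln_pow by exact PX; simpl; ring).
    apply ln_le; [apply pow_lt, PX|exact Hb6]. }
  assert (Hab : Rabs (IZR a / IZR b) <= / 2).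
  { unfold Rdiv; rewrite Rabs_mult, Rabs_inv, (Rabs_pos_eq (IZR b)) by lra.
    apply Rmult_le_reg_r with (IZR b); [exact Pb|].
    rewrite Rmult_assoc, Rinv_l, Rmult_1_r by lra.
    apply ln_le_inv; [lra|lra|].
    rewrite ln_mult, ln_Rinv by lra.
    pose proof (ln_le_half 2 ltac:(lra)); lra. }
  destruct (hyper_cv (INR r / INR s) (INR u / INR v) (IZR a / IZR b)) as [phi Hphi];
    [exact Hal|lra|lra|].
  exists phi; split; [exact Hphi|intros n M HM; apply Rle_ge].
  assert (LX : 0 < ln X) by lra.
  assert (LL : L * ln X = ln (IZR b)) by (unfold L; field; lra).
  assert (PL : 6 <= L).
  { apply Rmult_le_reg_r with (ln X); [exact LX|lra]. }
  (* Since [L * ln X = ln b], each entry of the maximum in [M0] becomes a lower bound for [M * ln X]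
     as a multiple of [ln b]. *)
  assert (HM' : forall y z, y <= z -> L * z <= INR M -> y * ln (IZR b) <= INR M * ln X).
  { intros y z Hyz Hz; rewrite <- LL.
    apply Rle_trans with (L * z * ln X); [|apply Rmult_le_compat_r; lra].
    replace (y * (L * ln X)) with (L * y * ln X) by ring.
    apply Rmult_le_compat_r; [lra|]; apply Rmult_le_compat_l; lra. }
  assert (M1 : 6 * (ln a2 + ln (Rabs (IZR a))) + ln (IZR b) / 2 <= INR M * ln X).
  { rewrite <- ln_mult by lra.
    replace (6 * ln (a2 * Rabs (IZR a)) + ln (IZR b) / 2)
      with ((6 * ln (a2 * Rabs (IZR a)) / ln (IZR b) + 1 / 2) * ln (IZR b)) by (field; lra).
    eapply HM'; [|exact HM].
    eapply Rle_trans; [apply Rmax_l|apply Rmax_l]. }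
  assert (M2 : (4 * t + 1) / 2 * ln (IZR b) <= INR M * ln X).
  { eapply HM'; [|exact HM]. eapply Rle_trans; [apply Rmax_r|apply Rmax_l]. }
  (* [5 / 2] is [(1 + 4) / 2], from the entry [4] of the innermost maximum. *)
  assert (M3 : 5 / 2 * ln (IZR b) <= INR M * ln X).
  { eapply HM'; [|exact HM].
    eapply Rle_trans; [|apply Rmax_r]; eapply Rle_trans; [|apply Rmax_r].
    pose proof (Rmax_r (Rmax ctheta cvth) 4); lra. }
  (* Follows from [L >= 6]; with [M <= N] it makes the hypothesis on [prime_pi] applicable at
     [N]. *)
  assert (M4 : ctheta <= INR M).
  { apply Rle_trans with (L * ((1 + ctheta) / 2)); [nra|].
    eapply Rle_trans; [|exact HM]; apply Rmult_le_compat_l; [lra|].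
    eapply Rle_trans; [|apply Rmax_r]; eapply Rle_trans; [|apply Rmax_r].
    pose proof (Rmax_l (Rmax ctheta cvth) 4); pose proof (Rmax_l ctheta cvth); lra. }
  set (lb := ln (IZR b)) in *; assert (Plb : 0 < lb) by lra.
  destruct (nat_floor (6 * INR M * ln X / lb)) as [K [HK1 HK2]].
  { apply Rmult_le_pos; [nra|apply Rlt_le, Rinv_0_lt_compat, Plb]. }
  assert (HK3 : INR K * lb <= 6 * INR M * ln X).
  { apply Rmult_le_compat_r with (r := lb) in HK1; [|lra].
    unfold Rdiv in HK1; rewrite Rmult_assoc, Rinv_l in HK1; lra. }
  assert (HK4 : 6 * INR M * ln X - lb <= INR K * lb).
  { apply Rlt_le, Rmult_le_compat_r with (r := lb) in HK2; [|lra].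
    unfold Rdiv in HK2; rewrite Rmult_assoc, Rinv_l in HK2; lra. }
  assert (HKM : INR K <= INR M).
  { apply Rmult_le_reg_r with lb; [exact Plb|].
    pose proof (Rmult_le_compat_l _ _ _ (pos_INR M) L6); lra. }
  (* [M3] gives [6 M ln X >= 15 lb], so the floor is not [0] and has a predecessor [k]. *)
  destruct K as [|k]; [simpl in HK4; lra|].
  apply INR_le in HKM as HkM.
  destruct (@HypergeometricPade.integer_pade_forms r s u v M k a b Hr Hs Hu Hv Hlt Ha Pb Hab HkM)
    as [C [q [p [q' [p' [PC [HC [F1 [F2 det]]]]]]]]].
  set (N := (u + 2 * M * v)%nat) in *.
  assert (IN : INR N = INR u + 2 * INR M * INR v)
    by (unfold N; rewrite plus_INR, !mult_INR; simpl (INR 2); ring).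
  assert (HN : INR M <= INR N) by nra.
  assert (ln2 : 0 < ln 2 <= 1).
  { split; [rewrite <- ln_1; apply ln_increasing; lra|].
    pose proof (ln_le_half 2 ltac:(lra)); lra. }
  assert (LC : ln C <= 6 * INR M * (INR s / 2) + 2 * INR M * (INR v / 2) +
      theta * (INR u + 2 * INR M * INR v) + (INR r + INR u + 1 + 6 * INR M)).
  { eapply Rle_trans; [apply ln_le; [exact PC|exact HC]|].
    rewrite !ln_mult by (repeat apply Rmult_lt_0_compat; try apply pow_lt; lra).
    rewrite !ln_pow, !plus_INR, !mult_INR by lra.
    rewrite <- IN; simpl (INR 1); replace (INR 6) with 6 by (simpl; ring).
    replace (INR 2) with 2 by (simpl; ring).
    pose proof (pos_INR M) as PM.
    pose proof (ln_le_half (INR s) ltac:(lra)) as ls.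
    pose proof (ln_le_half (INR v) ltac:(lra)) as lv.
    assert (lpi : INR (count_primes N) * ln (INR N) <= theta * INR N).
    { pose proof (Hct (INR N) ltac:(lra)) as Hpi; rewrite prime_pi_INR in Hpi.
      assert (0 < ln (INR N)) by (rewrite <- ln_1; apply ln_increasing; lra).
      apply Rmult_le_compat_r with (r := ln (INR N)) in Hpi; [|lra].
      unfold Rdiv in Hpi; rewrite Rmult_assoc, Rinv_l in Hpi; lra. }
    assert (6 * INR M * ln (INR s) <= 6 * INR M * (INR s / 2))
      by (apply Rmult_le_compat_l; lra).
    assert (2 * INR M * ln (INR v) <= 2 * INR M * (INR v / 2))
      by (apply Rmult_le_compat_l; lra).
    assert ((INR r + INR u + 1 + 6 * INR M) * ln 2 <= (INR r + INR u + 1 + 6 * INR M) * 1)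
      by (apply Rmult_le_compat_l; lra).
    lra. }
  set (G := (a1 ^ 18 * Rabs (IZR a) ^ 17) ^ M).
  assert (PG0 : 0 < a1 ^ 18 * Rabs (IZR a) ^ 17)
    by (apply Rmult_lt_0_compat; apply pow_lt; lra).
  assert (PG : 0 < G) by (apply pow_lt, PG0).
  assert (LB : ln (IZR B) <= t * lb).
  { unfold lb; rewrite <- (ln_exp (t * _)); apply ln_le; [exact PB|exact HBt]. }
  (* Both indices qualify: [j <= K <= j + 1] with [K = S k] is all that the floor bounds require. *)
  assert (est : forall j, (k <= j <= S k)%nat ->
      4 * IZR B * C * Rabs (IZR a) ^ S (M + j + j) <= IZR b ^ S j /\
      2 * C * IZR b ^ j <= G).
  { intros j [Hj1 Hj2].
    pose proof (le_INR _ _ Hj1) as Jj1; pose proof (le_INR _ _ Hj2) as Jj2.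
    rewrite S_INR in *.
    rewrite lnX in *.
    assert (JJ1 : 6 * INR M * (ln a1 + ln (Rabs (IZR a))) - lb <= (INR j + 1) * lb).
    { eapply Rle_trans; [exact HK4|]; apply Rmult_le_compat_r; lra. }
    assert (JJ2 : INR j * lb <= 6 * INR M * (ln a1 + ln (Rabs (IZR a)))).
    { eapply Rle_trans; [|exact HK3]; apply Rmult_le_compat_r; lra. }
    destruct (log_estimates (INR r0) (INR s0) (INR r) (INR s) (INR u) (INR v) theta t
      (ln a1) (ln a2) (ln (Rabs (IZR a))) lb (ln (IZR B)) (ln C) (INR M) (INR j))
      as [X1 X2]; try assumption; try lra.
    split.
    - apply ln_le_inv;
        [repeat apply Rmult_lt_0_compat; try apply pow_lt; lra|apply pow_lt, Pb|].
      rewrite !ln_mult by (repeat apply Rmult_lt_0_compat; try apply pow_lt; lra).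
      rewrite !ln_pow, !S_INR, !plus_INR by lra; fold lb.
      replace 4 with (2 * 2) by ring; rewrite ln_mult by lra; lra.
    - apply ln_le_inv;
        [repeat apply Rmult_lt_0_compat; try apply pow_lt; lra|exact PG|].
      unfold G; rewrite (ln_pow _ PG0).
      rewrite !ln_mult by (repeat apply Rmult_lt_0_compat; try apply pow_lt; lra).
      rewrite !ln_pow by lra; fold lb.
      replace (INR 18) with 18 by (simpl; ring).
      replace (INR 17) with 17 by (simpl; ring); lra. }
  destruct (est k ltac:(lia)) as [e1 g1]; destruct (est (S k) ltac:(lia)) as [e2 g2].
  pose proof (approx_form_limit _ _ _ _ _ _ _ _ _ _ F1 (Rlt_le _ _ Pb) Hphi) as l1.
  pose proof (approx_form_limit _ _ _ _ _ _ _ _ _ _ F2 (Rlt_le _ _ Pb) Hphi) as l2.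
  destruct (Z.eq_dec (q * n) (B * p)) as [Heq|Hne].
  - destruct (Z.eq_dec (q' * n) (B * p')) as [Heq'|Hne'].
    (* Both equalities give [B q' p = q' q n = B q p'], and [B] cancels. *)
    + exfalso; apply det.
      assert (HBZ : B <> 0%Z) by lia.
      apply (Z.mul_reg_l _ _ B HBZ).
      replace (B * (q' * p))%Z with (q' * (B * p))%Z by ring.
      rewrite <- Heq; replace (B * (q * p'))%Z with (q * (B * p'))%Z by ring.
      rewrite <- Heq'; ring.
    + exact (gap_of_form a b B n q' p' C G phi M (S k) Pb PB PG Hne' (proj1 F2) l2 e2 g2).
  - exact (gap_of_form a b B n q p C G phi M k Pb PB PG Hne (proj1 F1) l1 e1 g1).
Qed.
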